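(* Let $a$ and $b$ be positive integers with $a\mid b$, and let $S=\{x_1,\dots,x_n\}$ be a gcd-closed set of $n$ distinct positive integers such that $\max_{x\in S}|G_S(x)|=2$ and $S$ satisfies the condition $\mathcal{G}$. Then $(S^a)\mid(S^b)$, $(S^a)\mid[S^b]$ and $[S^a]\mid[S^b]$ hold in the ring $M_n(\mathbb{Z})$.
   Context: For positive integers $x,y$, $(x,y)$ and $[x,y]$ denote their gcd and lcm. A finite set $S=\{x_1,\dots,x_n\}$ of distinct positive integers is gcd closed if $(x_i,x_j)\in S$ for all $1\le i,j\le n$. $(S^a)$ denotes the $n\times n$ matrix with $(i,j)$-entry $(x_i,x_j)^a$ and $[S^a]$ the $n\times n$ matrix with $(i,j)$-entry $[x_i,x_j]^a$. For $x,y\in S$ with $x<y$, $x$ is a greatest-type divisor of $y$ in $S$ if $x\mid y$ and whenever $d\in S$ with $x\mid d\mid y$ then $d\in\{x,y\}$; $G_S(y)$ is the set of greatest-type divisors of $y$ in $S$. Two distinct elements $y_1,y_2\in G_S(x)$ satisfy condition $\mathcal{G}$ if $[y_1,y_2]=x$ and $(y_1,y_2)\in G_S(y_1)\cap G_S(y_2)$; $x$ satisfies condition $\mathcal{G}$ if any two distinct elements of $G_S(x)$ satisfy condition $\mathcal{G}$; a set $S$ satisfies condition $\mathcal{G}$ if every $x\in S$ has either $|G_S(x)|\le1$, or $|G_S(x)|\ge 2$ and $x$ satisfies condition $\mathcal{G}$. For $A,B\in M_n(\mathbb{Z})$, $A\mid B$ in $M_n(\mathbb{Z})$ means there exists $C\in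 M_n(\mathbb{Z})$ with $B=AC$ or $B=CA$. *)

(* Defs.v *)
From mathcomp Require Import all_boot all_order all_algebra.

Set Implicit Arguments.
Unset Strict Implicit.
Unset Printing Implicit Defensive.

(* A finite set of integers is a sequence S together with the hypothesis
   [uniq S]; the order of S is the order of the rows and columns of the
   matrices below. *)

Definition gcd_closed (S : seq nat) : Prop :=
  forall x y, x \in S -> y \in S -> gcdn x y \in S.

Definition greatest_type_divisor (S : seq nat) (x y : nat) : bool :=
  [&& x \in S, y \in S, x < y, x %| y
    & all (fun d => (x %| d) && (d %| y) ==> (d \in [:: x; y])) S].

(* This is G_S(y). When S is duplicate-free so is this sequence, and its size
   is then the cardinality of G_S(y). *)
Definition gtdivs (S : seq nat) (y : nat) : seq nat :=
  [seq x <- S | greatest_type_divisor S x y].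

Definition pair_condG (S : seq nat) (x y1 y2 : nat) : Prop :=
  lcmn y1 y2 = x /\
  (gcdn y1 y2 \in gtdivs S y1 /\ gcdn y1 y2 \in gtdivs S y2).

Definition elt_condG (S : seq nat) (x : nat) : Prop :=
  forall y1 y2, y1 \in gtdivs S x -> y2 \in gtdivs S x -> y1 <> y2 ->
    pair_condG S x y1 y2.

Definition set_condG (S : seq nat) : Prop :=
  forall x, x \in S ->
    size (gtdivs S x) <= 1 \/ (2 <= size (gtdivs S x) /\ elt_condG S x).

Definition power_gcd_mx (n : nat) (S : n.-tuple nat) (a : nat) : 'M[int]_n :=
  (\matrix_(i < n, j < n) Posz (gcdn (tnth S i) (tnth S j) ^ a))%R.

Definition power_lcm_mx (n : nat) (S : n.-tuple nat) (a : nat) : 'M[int]_n :=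
  (\matrix_(i < n, j < n) Posz (lcmn (tnth S i) (tnth S j) ^ a))%R.

Definition mx_divides (n : nat) (A B : 'M[int]_n) : Prop :=
  exists C : 'M[int]_n, B = (A *m C)%R \/ B = (C *m A)%R.

(* Main.v *)
(* Write [S^a] and (S^a) as F D F^T, where F is unitriangular, indexed by the
   divisibility order of S, and D is diagonal (F has entries [y | x] for (S^a)
   and [y | x] (x / y)^a for [S^a]). Since F is invertible over the integers, a
   symmetric B is a multiple of F D F^T as soon as each diagonal entry of D
   divides the corresponding Moebius difference of the rows of B.
   If x has two greatest-type divisors y1, y2 with gcd g, condition G gives
   y1 = g u, y2 = g v, x = g u v, so the diagonal entry is
   g^a (u^a - 1) (v^a - 1) up to a power of u v. The Moebius difference of
   lcm(z, .)^b at x either is taken at divisors of z or has a factor v^b - v^c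
   (or u^b - u^c), the other factor being a difference along the edge from g
   to y1 (or y2), which is treated in dvdz_lcm_diff. *)
Require Import Defs.
From mathcomp Require Import all_boot all_order all_algebra.
From mathcomp Require Import ring zify.

Set Implicit Arguments.
Unset Strict Implicit.
Unset Printing Implicit Defensive.

Import GRing.Theory.

(** * Arithmetic of lcms and of differences of powers *)

(** The hypothesis forces gcd(z, y r) = gcd(z, y); since lcm times gcd is the product, the factor r
    passes to the lcm. *)
Lemma lcmn_mulr_cofactor (z y r : nat) :
  0 < y -> gcdn z (y * r) %| y -> lcmn z (y * r) = r * lcmn z y.
Proof.
move=> y_gt0 dvd_y.
have gcdE : gcdn z (y * r) = gcdn z y.
  apply/eqP; rewrite eqn_dvd !dvdn_gcd !dvdn_gcdl dvd_y /=.
  by rewrite dvdn_mulr ?dvdn_gcdr.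
have d_gt0 : 0 < gcdn z y by rewrite gcdn_gt0 y_gt0 orbT.
apply/eqP; rewrite -(eqn_pmul2r d_gt0) -{1}gcdE muln_lcm_gcd -mulnA.
by rewrite muln_lcm_gcd mulnA mulnC.
Qed.

Lemma PoszX (m n : nat) : Posz (m ^ n) = (Posz m ^+ n)%R.
Proof. by rewrite -!natz natrX. Qed.

(** Here x^d - x^c = x^c (x^(d-c) - 1), and a divides d - c. *)
Lemma dvdz_subXX (x : int) (a c d : nat) :
  a %| c -> a %| d -> c <= d -> (x ^+ c * (x ^+ a - 1) %| (x ^+ d - x ^+ c)%R)%Z.
Proof.
move=> a_c a_d le_cd.
rewrite -{1}(subnKC le_cd) exprD -[X in (_ - X)%R]mulr1 -mulrBr.
rewrite dvdz_mul //.
have /dvdnP[k ->] : a %| d - c by rewrite dvdn_sub.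
by rewrite mulnC exprM (subrX1 (x ^+ a)) dvdz_mulr.
Qed.

(* In general this would be the sum of mu(y, x) (x / y)^c f y over the divisors
   y of x in S; condition G and |G_S(x)| <= 2 leave only the terms below. The
   weight c is 0 for power gcd matrices and a for power lcm matrices. *)
Definition mobius_diff (S : seq nat) (c x : nat) (f : nat -> int) : int :=
  match gtdivs S x with
  | [::] => f x
  | [:: y] => f x - (x %/ y)%:Z ^+ c * f y
  | y1 :: y2 :: _ =>
      f x - (x %/ y1)%:Z ^+ c * f y1 - (x %/ y2)%:Z ^+ c * f y2
      + (x %/ gcdn y1 y2)%:Z ^+ c * f (gcdn y1 y2)
  end%R.

(** * Greatest-type divisors under condition G *)

Section GcdClosed.

Variable S : seq nat.
Hypothesis S_pos : forall x, x \in S -> 0 < x.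
Hypothesis S_gcd : gcd_closed S.

Lemma mem_gtdivs (x y : nat) :
  y \in gtdivs S x ->
  [/\ y \in S, x \in S, y < x, y %| x
    & forall d, d \in S -> y %| d -> d %| x -> d = y \/ d = x].
Proof.
rewrite mem_filter => /andP[/and5P[yS xS ltyx y_x /allP max_y] _].
split=> // d dS y_d d_x.
by move: (max_y d dS); rewrite y_d d_x !inE => /orP[]/eqP; auto.
Qed.

(** Induction on x - w: if w is not itself of greatest type, some d of S strictly between w and x
    takes its place. *)
Lemma gtdivs_above (w x : nat) :
  w \in S -> x \in S -> w %| x -> w != x ->
  exists2 y, y \in gtdivs S x & w %| y.
Proof.
have [k] := ubnP (x - w); elim: k w => // k IHk w ltk wS xS w_x neq_wx.
have lt_wx : w < x by rewrite ltn_neqAle neq_wx dvdn_leq // S_pos.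
have [gtd_w|] := boolP (greatest_type_divisor S w x).
  by exists w; rewrite // mem_filter gtd_w.
rewrite /greatest_type_divisor wS xS lt_wx w_x /= -has_predC.
case/hasP=> d dS /=; rewrite negb_imply !inE negb_or.
case/andP=> /andP[w_d d_x] /andP[neq_dw neq_dx].
have lt_wd : w < d by rewrite ltn_neqAle eq_sym neq_dw dvdn_leq // S_pos.
have [|y y_x d_y] := IHk d _ dS xS d_x neq_dx; first by lia.
by exists y => //; apply: dvdn_trans d_y.
Qed.

Hypothesis S_G : set_condG S.

(** With y1 = g u and y2 = g v, the identity lcm(y1, y2) g = y1 y2 becomes x g = g u g v, and g
    cancels. *)
Lemma condG_pair (x y1 y2 : nat) :
  y1 \in gtdivs S x -> y2 \in gtdivs S x -> y1 != y2 ->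
  exists g u v, [/\ g = gcdn y1 y2, y1 = g * u, y2 = g * v, x = g * u * v
    & g \in gtdivs S y1 /\ g \in gtdivs S y2].
Proof.
move=> y1x y2x neq12; have [y1S xS _ _ _] := mem_gtdivs y1x.
have [y2S _ _ _ _] := mem_gtdivs y2x.
have [small|[_ condG_x]] := S_G xS.
  case: (gtdivs S x) small y1x y2x => [|y [|//]] // _; rewrite !inE.
  by move=> /eqP e1 /eqP e2; rewrite e1 e2 eqxx in neq12.
have [lcmE [g1 g2]] := condG_x _ _ y1x y2x (elimN eqP neq12).
have [gS _ _ /dvdnP[u y1E] _] := mem_gtdivs g1.
have [_ _ _ /dvdnP[v y2E] _] := mem_gtdivs g2.
exists (gcdn y1 y2), u, v; split=> //; rewrite ?[gcdn _ _ * _]mulnC //.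
have g_gt0 := S_pos gS; have E := muln_lcm_gcd y1 y2.
apply/eqP; rewrite -(eqn_pmul2r g_gt0) -lcmE E; apply/eqP.
by rewrite [LHS](congr2 muln y1E y2E); ring.
Qed.

(** The possible shapes of S just below x. Quotients are replaced by cofactors, so later proofs need
    not unfold [mobius_diff]. *)
Variant mobius_spec (x : nat) : Prop :=
  | MobiusMinimal of
      forall w, w \in S -> w %| x -> w = x
    & forall c f, mobius_diff S c x f = f x
  | MobiusChain y r of
      x = y * r & y \in gtdivs S x
    & forall w, w \in S -> w %| x -> w = x \/ w %| y
    & forall c f, mobius_diff S c x f = (f x - r%:Z ^+ c * f y)%R
  | MobiusDiamond g u v of
      x = g * u * v & g * u \in gtdivs S x & g * v \in gtdivs S x
    & g = gcdn (g * u) (g * v)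
    & g \in gtdivs S (g * u) & g \in gtdivs S (g * v)
    & forall w, w \in S -> w %| x -> [\/ w = x, w %| g * u | w %| g * v]
    & forall c f, mobius_diff S c x f =
        (f x - v%:Z ^+ c * f (g * u)%N - u%:Z ^+ c * f (g * v)%N
         + (u * v)%:Z ^+ c * f g)%R.

(* Strong induction on y: if gcd(z, y) <> y does not divide g, it divides
   another w in G_S(y), and condition G makes (w, gcd(g, w)) a pair with
   the same ratio r as (y, g), the two being proportional. *)
Lemma dvdz_lcm_diff (a b c z y g r : nat) :
  0 < b -> a %| b -> c = 0 \/ c = a -> z \in S -> g \in gtdivs S y -> y = g * r ->
  (g%:Z ^+ a * (r%:Z ^+ c * (r%:Z ^+ a - 1)) %|
   ((lcmn z y)%:Z ^+ b - r%:Z ^+ c * (lcmn z g)%:Z ^+ b)%R)%Z.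
Proof.
move=> b_gt0 a_b c_a zS.
have le_ab : a <= b by apply: dvdn_leq.
have a_c : a %| c by case: c_a => ->; rewrite ?dvdn0.
have le_cb : c <= b by case: c_a => ->.
have [k] := ubnP y; elim: k y g => // k IHk y g ltk g_y yE.
have [gS yS lt_gy dvd_gy g_max] := mem_gtdivs g_y.
have g_gt0 := S_pos gS.
have dS := S_gcd zS yS.
(* If y | z, both lcms are z and the difference is z^b (1 - r^c): zero for c = 0, and for c = a a
   multiple of y^a (r^a - 1), where y^a = g^a r^a. *)
have [y_z|y_nz] := boolP (y %| z).
  have g_z := dvdn_trans dvd_gy y_z.
  rewrite (lcmn_idPl y_z) (lcmn_idPl g_z).
  have -> : (z%:Z ^+ b - r%:Z ^+ c * z%:Z ^+ b = z%:Z ^+ b * (1 - r%:Z ^+ c))%R by ring.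
  case: c_a => ->; first by rewrite subrr mulr0 dvdz0.
  rewrite mulrA -exprMn -PoszM -yE -[(1 - _)%R]opprB dvdz_mul ?rpredN //.
  apply: dvdz_trans (dvdz_exp2l _ le_ab); apply: dvdz_exp2r.
  by rewrite dvdzE.
have neq_dy : gcdn z y != y by apply: contra y_nz => /eqP<-; apply: dvdn_gcdl.
(* If gcd(z, y) | g, then lcm(z, y) = r lcm(z, g), and the difference is lcm(z, g)^b (r^b - r^c). *)
have [d_g|d_ng] := boolP (gcdn z y %| g).
  rewrite yE lcmn_mulr_cofactor -?yE // PoszM exprMn -mulrBl mulrC.
  rewrite dvdz_mul ?dvdz_subXX //.
  apply: dvdz_trans (dvdz_exp2l _ le_ab); apply: dvdz_exp2r.
  by rewrite dvdzE dvdn_lcmr.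
have [w w_y d_w] := gtdivs_above dS yS (dvdn_gcdr z y) neq_dy.
have neq_wg : w != g by apply: contra d_ng => /eqP<-.
have [h [u [v [hE wE gE yE2 [h_w h_g]]]]] := condG_pair w_y g_y neq_wg.
have [wS _ lt_wy _ _] := mem_gtdivs w_y; have [hS _ _ _ _] := mem_gtdivs h_w.
have h_gt0 := S_pos hS.
have rE : r = u by apply/eqP; rewrite -(eqn_pmul2l g_gt0) -yE yE2 gE mulnAC.
have y_wv : y = w * v by rewrite yE2 wE.
have lcm_y : lcmn z y = v * lcmn z w.
  by rewrite y_wv lcmn_mulr_cofactor -?y_wv // S_pos.
(* gcd(z, g) divides gcd(z, y), hence w; it also divides g, hence it divides h. *)
have lcm_g : lcmn z g = v * lcmn z h.
  rewrite gE lcmn_mulr_cofactor // -gE hE dvdn_gcd dvdn_gcdr andbT.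
  apply: dvdn_trans d_w; rewrite dvdn_gcd dvdn_gcdl /=.
  exact: dvdn_trans (dvdn_gcdr _ _) dvd_gy.
have {}IHk : (h%:Z ^+ a * (r%:Z ^+ c * (r%:Z ^+ a - 1)) %|
    ((lcmn z w)%:Z ^+ b - r%:Z ^+ c * (lcmn z h)%:Z ^+ b)%R)%Z.
  by apply: IHk => //; [apply: leq_trans lt_wy _; rewrite -ltnS | rewrite wE rE].
(* Passing from (w, h) to (y, g) scales the divisor by v^a and the difference by v^b. *)
rewrite lcm_y lcm_g gE !PoszM.
have -> : ((h%:Z * v%:Z) ^+ a * (r%:Z ^+ c * (r%:Z ^+ a - 1)) =
    v%:Z ^+ a * (h%:Z ^+ a * (r%:Z ^+ c * (r%:Z ^+ a - 1))))%R.
  by rewrite exprMn; ring.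
have -> : ((v%:Z * (lcmn z w)%:Z) ^+ b - r%:Z ^+ c * (v%:Z * (lcmn z h)%:Z) ^+ b =
    v%:Z ^+ b * ((lcmn z w)%:Z ^+ b - r%:Z ^+ c * (lcmn z h)%:Z ^+ b))%R.
  by rewrite !exprMn; ring.
by apply: dvdz_mul => //; apply: dvdz_exp2l.
Qed.

Hypothesis S_uniq : uniq S.
Hypothesis S_max : forall x, x \in S -> size (gtdivs S x) <= 2.

Lemma mobius_diffP (x : nat) : x \in S -> mobius_spec x.
Proof.
move=> xS; have size_x := S_max xS; have := gtdivs_above _ xS.
have : uniq (gtdivs S x) by rewrite filter_uniq.
case E: (gtdivs S x) size_x => [|y1 [|y2 [|//]]] _ uq above.
- apply: MobiusMinimal => [w wS w_x|c f]; last by rewrite /mobius_diff E.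
  by apply/eqP; apply: contraT => /(above w wS w_x)[y].
- have y1x : y1 \in gtdivs S x by rewrite E inE.
  have [y1S _ _ /dvdnP[r xE] _] := mem_gtdivs y1x.
  have r_eq : x %/ y1 = r by rewrite xE mulnK ?S_pos.
  apply: (@MobiusChain _ y1 r) => [||w wS w_x|c f] //; first by rewrite mulnC.
    have [|/(above w wS w_x)[y]] := eqVneq w x; first by left.
    by rewrite inE => /eqP->; right.
  by rewrite /mobius_diff E r_eq.
- have y1x : y1 \in gtdivs S x by rewrite E !inE eqxx.
  have y2x : y2 \in gtdivs S x by rewrite E !inE eqxx orbT.
  have neq12 : y1 != y2 by move: uq; rewrite /= inE andbT.
  have [g [u [v [gE y1E y2E xE [g1 g2]]]]] := condG_pair y1x y2x neq12.
  have [y1S _ _ _ _] := mem_gtdivs y1x; have [y2S _ _ _ _] := mem_gtdivs y2x.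
  have [gS _ _ _ _] := mem_gtdivs g1.
  apply: (@MobiusDiamond _ g u v); rewrite -?y1E -?y2E //.
  + by rewrite xE y1E.
  + move=> w wS w_x; have [|/(above w wS w_x)[y]] := eqVneq w x.
      by constructor 1.
    by rewrite !inE => /orP[]/eqP->; [constructor 2|constructor 3].
  + move=> c f; rewrite /mobius_diff E -gE.
    have -> : x %/ y1 = v by rewrite xE -y1E mulKn ?S_pos.
    have -> : x %/ y2 = u by rewrite xE mulnAC -y2E mulKn ?S_pos.
    by have -> : x %/ g = u * v by rewrite xE -mulnA mulKn ?S_pos.
Qed.


(** * Moebius differences as linear functionals, and Moebius inversion *)

Lemma gtdivs_pos (x y : nat) : y \in gtdivs S x -> 0 < y.
Proof. by move=> /mem_gtdivs[/S_pos]. Qed.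

Lemma mobius_diff_eq (c x : nat) (f1 f2 : nat -> int) :
  x \in S -> (forall w, w \in S -> w %| x -> f1 w = f2 w) ->
  mobius_diff S c x f1 = mobius_diff S c x f2.
Proof.
move=> xS eq_f; have eq_x := eq_f x xS (dvdnn x).
case: (mobius_diffP xS) => [_ E|y r xE y_x _ E|g u v xE ux vx _ gu gv _ E].
- by rewrite !E.
- by have [yS _ _ dvd_yx _] := mem_gtdivs y_x; rewrite !E eq_x eq_f.
- have [uS _ _ u_x _] := mem_gtdivs ux; have [vS _ _ v_x _] := mem_gtdivs vx.
  have [gS _ _ g_u _] := mem_gtdivs gu.
  by rewrite !E eq_x (eq_f _ uS) // (eq_f _ vS) // (eq_f _ gS) // (dvdn_trans g_u).
Qed.

Lemma mobius_diffZ (c x : nat) (k : int) (f : nat -> int) :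
  x \in S ->
  mobius_diff S c x (fun y => k * f y)%R = (k * mobius_diff S c x f)%R.
Proof.
by case/mobius_diffP => [_|y r _ _ _|g u v _ _ _ _ _ _ _] E; rewrite !E; ring.
Qed.

(** Expand f in the indicator functions of the elements of S. This makes [mobius_diff] a matrix row
    applied to the values of f. *)
Lemma mobius_diff_sum (c x : nat) (f : nat -> int) :
  x \in S ->
  (\sum_(s <- S) mobius_diff S c x (fun y => (y == s)%:R) * f s)%R =
  mobius_diff S c x f.
Proof.
have f_sum y : y \in S -> f y = (\sum_(s <- S) (y == s)%:R * f s)%R.
  move=> yS; rewrite (bigD1_seq y) //= eqxx mul1r big1 ?addr0 // => s.
  by rewrite eq_sym => /negPf->; rewrite mul0r.
move=> xS.
case: (mobius_diffP xS) => [_ E|y r xE y_x _ E|g u v xE ux vx _ gu gv _ E].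
- by rewrite E f_sum //; apply: eq_bigr => s _; rewrite E.
- have [yS _ _ _ _] := mem_gtdivs y_x.
  rewrite E (f_sum x) // (f_sum y) // mulr_sumr -sumrB.
  by apply: eq_bigr => s _; rewrite E; ring.
- have [uS _ _ _ _] := mem_gtdivs ux; have [vS _ _ _ _] := mem_gtdivs vx.
  have [gS _ _ _ _] := mem_gtdivs gu.
  rewrite E (f_sum x) // (f_sum _ uS) (f_sum _ vS) (f_sum _ gS) !mulr_sumr.
  rewrite -!sumrB -big_split /=.
  by apply: eq_bigr => s _; rewrite E; ring.
Qed.

(** Weighted zeta function of the divisibility order; [mobius_diff] with the same c inverts it. *)
Definition weighted_dvd (c y w : nat) : int :=
  if w %| y then ((y %/ w)%:Z ^+ c)%R else 0%R.

(** Each term with w | y contributes (x/w)^c up to sign. For w <> x these cancel by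
    inclusion-exclusion: in the diamond, w | x iff w divides g u or g v, and w | g iff it divides
    both. *)
Lemma mobius_diff_weighted_dvd (c x w : nat) :
  x \in S -> w \in S ->
  mobius_diff S c x (fun y => weighted_dvd c y w) = (x == w)%:R%R.
Proof.
move=> xS wS; have w_gt0 := S_pos wS; rewrite /weighted_dvd.
have [<-{w wS w_gt0}|neq_xw] := eqVneq x w.
  have x_gt0 := S_pos xS.
  have ndvd y : y \in gtdivs S x -> (x %| y) = false.
    move=> y_x; have [_ _ lt_yx _ _] := mem_gtdivs y_x.
    by apply/negP => /dvdn_leq; rewrite (gtdivs_pos y_x) leqNgt lt_yx => /(_ isT).
  case: (mobius_diffP xS) => [_ ->|y r xE y_x _ ->|g u v xE ux vx _ gu gv _ ->].
  - by rewrite dvdnn divnn x_gt0 expr1n.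
  - by rewrite dvdnn divnn x_gt0 expr1n ndvd // mulr0 subr0.
  - have x_g : (x %| g) = false.
      by apply: contraFF (ndvd _ ux) => x_g; rewrite dvdn_mulr.
    by rewrite dvdnn divnn x_gt0 expr1n x_g !ndvd // !(mulr0, subr0, addr0).
rewrite [RHS]mulr0n.
have quotM k y : w %| y -> Posz (k * y %/ w) = (k%:Z * (y %/ w)%:Z)%R.
  by move=> w_y; rewrite -muln_divA // PoszM.
case: (mobius_diffP xS) => [minx ->|y r xE y_x below ->|].
- by case: ifP => // /(minx w wS) wx; rewrite wx eqxx in neq_xw.
- have [w_y|w_ny] := boolP (w %| y).
    by rewrite xE mulnC dvdn_mull // quotM // exprMn subrr.
  case: ifP => [/(below w wS)[wx|]|]; last by rewrite mulr0 subr0.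
    by rewrite wx eqxx in neq_xw.
  by rewrite (negPf w_ny).
move=> g u v xE _ _ gE _ _ below ->.
have w_gE : (w %| g) = (w %| g * u) && (w %| g * v) by rewrite {1}gE dvdn_gcd.
have w_xE : (w %| x) = (w %| g * u) || (w %| g * v).
  apply/idP/orP => [/(below w wS)[wx||]|[]]; [|by left|by right| |].
  - by rewrite wx eqxx in neq_xw.
  - by rewrite xE => ?; rewrite dvdn_mulr.
  - by rewrite xE mulnAC => ?; rewrite dvdn_mulr.
have quotx k y : x = k * y -> w %| y -> Posz (x %/ w) = (k%:Z * (y %/ w)%:Z)%R.
  by move=> -> w_y; rewrite quotM.
have x_g : x = (u * v) * g by rewrite xE; ring.
have x_u : x = v * (g * u) by rewrite xE; ring.
have x_v : x = u * (g * v) by rewrite xE; ring.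
have [w_u|w_nu] := boolP (w %| g * u); have [w_v|w_nv] := boolP (w %| g * v);
  rewrite ?w_u ?w_v ?(negPf w_nu) ?(negPf w_nv) /= in w_gE w_xE;
  rewrite w_gE w_xE.
- rewrite (quotx _ _ x_g) // ![g * _]mulnC !quotM // !PoszM !exprMn; ring.
- by rewrite (quotx _ _ x_u) // exprMn; ring.
- by rewrite (quotx _ _ x_v) // exprMn; ring.
- by ring.
Qed.

(** * Vanishing and divisibility of the Moebius differences of power gcds and lcms *)

(** gcd(z, x) lies in S properly below x, so it divides some y in G_S(x), or x is minimal, which is
    absurd. Then gcd(z, x) = gcd(z, y), in the diamond the gcds at the other two vertices agree as
    well, and the terms cancel in pairs. *)
Lemma mobius_diff_gcd0 (b x z : nat) :
  x \in S -> z \in S -> ~~ (x %| z) ->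
  mobius_diff S 0 x (fun y => (gcdn z y)%:Z ^+ b)%R = 0%R.
Proof.
move=> xS zS x_nz; have dS := S_gcd zS xS.
have neq_dx : gcdn z x <> x by move=> E; rewrite -E dvdn_gcdl in x_nz.
have gcd_eq y1 y2 : y1 %| y2 -> gcdn z y2 %| y1 -> gcdn z y2 = gcdn z y1.
  move=> y12 d1; apply/eqP; rewrite eqn_dvd !dvdn_gcd !dvdn_gcdl d1 /=.
  by apply: dvdn_trans y12; apply: dvdn_gcdr.
case: (mobius_diffP xS) => [minx|y r xE y_x below ->|].
- by have := minx _ dS (dvdn_gcdr _ _).
- case: (below _ dS (dvdn_gcdr _ _)) => // d_y.
  have [_ _ _ dvd_yx _] := mem_gtdivs y_x.
  by rewrite (gcd_eq y x) //; ring.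
move=> g u v xE ux vx gE gu gv below ->.
have [_ _ _ u_x _] := mem_gtdivs ux; have [_ _ _ v_x _] := mem_gtdivs vx.
have [_ _ _ g_u _] := mem_gtdivs gu; have [_ _ _ g_v _] := mem_gtdivs gv.
have sub_d y : y %| x -> gcdn z y %| gcdn z x.
  by move=> y_x; rewrite dvdn_gcd dvdn_gcdl /= (dvdn_trans (dvdn_gcdr _ _)).
case: (below _ dS (dvdn_gcdr _ _)) => // d_y.
- rewrite (gcd_eq (g * u) x) // (gcd_eq g (g * v)) //; first by ring.
  by rewrite [X in _ %| X]gE dvdn_gcd dvdn_gcdr andbT (dvdn_trans (sub_d _ v_x)).
- rewrite (gcd_eq (g * v) x) // (gcd_eq g (g * u)) //; first by ring.
  by rewrite [X in _ %| X]gE dvdn_gcd dvdn_gcdr /= (dvdn_trans (sub_d _ u_x)).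
Qed.

(** The edges from g u to x and from g to g v are parallel, with ratio v. As gcd(z, g v) divides
    gcd(z, x), it divides g u and g v, hence g, so the lcm scales by v along both. *)
Lemma lcmn_diamond (x z g u v : nat) :
  x = g * u * v -> g * u \in gtdivs S x -> g * v \in gtdivs S x ->
  g = gcdn (g * u) (g * v) -> g \in gtdivs S (g * u) -> gcdn z x %| g * u ->
  lcmn z x = v * lcmn z (g * u) /\ lcmn z (g * v) = v * lcmn z g.
Proof.
move=> xE ux vx gE gu d_u; have [_ _ _ v_x _] := mem_gtdivs vx.
split; first by rewrite xE lcmn_mulr_cofactor -?xE ?(gtdivs_pos ux).
rewrite lcmn_mulr_cofactor ?(gtdivs_pos gu) //.
rewrite [X in _ %| X]gE dvdn_gcd dvdn_gcdr andbT (dvdn_trans _ d_u) //.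
by rewrite dvdn_gcd dvdn_gcdl (dvdn_trans (dvdn_gcdr _ _)).
Qed.

(** Cancellation in pairs as for gcds, the weight absorbing the factor by which the lcm grows along
    each edge. *)
Lemma mobius_diff_lcm0 (a x z : nat) :
  x \in S -> z \in S -> ~~ (x %| z) ->
  mobius_diff S a x (fun y => (lcmn z y)%:Z ^+ a)%R = 0%R.
Proof.
move=> xS zS x_nz; have dS := S_gcd zS xS.
have neq_dx : gcdn z x <> x by move=> E; rewrite -E dvdn_gcdl in x_nz.
case: (mobius_diffP xS) => [minx|y r xE y_x below ->|].
- by have := minx _ dS (dvdn_gcdr _ _).
- case: (below _ dS (dvdn_gcdr _ _)) => // d_y.
  rewrite {1}xE lcmn_mulr_cofactor -?xE ?(gtdivs_pos y_x) // PoszM exprMn.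
  by rewrite subrr.
move=> g u v xE ux vx gE gu gv below ->.
case: (below _ dS (dvdn_gcdr _ _)) => // d_y.
  have [-> ->] := lcmn_diamond xE ux vx gE gu d_y.
  by rewrite !PoszM !exprMn; ring.
have [||-> ->] := lcmn_diamond _ vx ux _ gv d_y.
- by rewrite mulnAC.
- by rewrite gcdnC.
by rewrite !PoszM !exprMn; ring.
Qed.

(* For c = 0 (resp. c = a) the left-hand side is the Moebius difference of
   y |-> gcd(x, y)^a (resp. lcm(x, y)^a). *)
Lemma dvdz_mobius_diff_lcm (a b c x z : nat) :
  0 < b -> a %| b -> c = 0 \/ c = a -> x \in S -> z \in S ->
  (mobius_diff S c x (fun y => y%:Z ^+ a * (x %/ y)%:Z ^+ c)%R %|
   mobius_diff S c x (fun y => (lcmn z y)%:Z ^+ b)%R)%Z.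
Proof.
move=> b_gt0 a_b c_a xS zS; have dS := S_gcd zS xS; have x_gt0 := S_pos xS.
have le_ab : a <= b by apply: dvdn_leq.
have a_c : a %| c by case: c_a => ->; rewrite ?dvdn0.
have le_cb : c <= b by case: c_a => ->.
case: (mobius_diffP xS) => [minx E|y r xE y_x below E|].
- rewrite !E divnn x_gt0 expr1n mulr1.
  apply: dvdz_trans (dvdz_exp2l _ le_ab); apply: dvdz_exp2r.
  by rewrite dvdzE dvdn_lcmr.
- rewrite !E divnn x_gt0 expr1n mulr1.
  have -> : x %/ y = r by rewrite xE mulKn // (gtdivs_pos y_x).
  apply: dvdz_trans (dvdz_lcm_diff b_gt0 a_b c_a zS y_x xE).
  (* The diagonal entry x^a - r^(2c) y^a is y^a r^c (r^a - 1) for c = 0 and its opposite for c =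
     a. *)
  rewrite xE PoszM exprMn; case: c_a => ->; first by apply/dvdzP; exists 1%R; ring.
  by apply/dvdzP; exists (- 1)%R; ring.
move=> g u v xE ux vx gE gu gv below E.
have u_gt0 := gtdivs_pos ux; have v_gt0 := gtdivs_pos vx; have g_gt0 := gtdivs_pos gu.
have DE : mobius_diff S c x (fun y => y%:Z ^+ a * (x %/ y)%:Z ^+ c)%R =
    (g%:Z ^+ a * (u%:Z ^+ c * (u%:Z ^+ a - 1)) * (v%:Z ^+ c * (v%:Z ^+ a - 1)))%R.
  rewrite E divnn x_gt0 expr1n mulr1.
  have -> : x %/ (g * u) = v by rewrite xE mulKn.
  have -> : x %/ (g * v) = u by rewrite xE mulnAC mulKn.
  have -> : x %/ g = u * v by rewrite xE -mulnA mulKn.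
  by rewrite xE !PoszM !exprMn; case: c_a => ->; ring.
(* If x | z, all lcms are z and the difference is z^b (1 - u^c) (1 - v^c); for c = a it remains to
   use x^a | z^b. *)
rewrite DE {DE} E; have [x_z|x_nz] := boolP (x %| z).
  have [_ _ _ u_x _] := mem_gtdivs ux; have [_ _ _ v_x _] := mem_gtdivs vx.
  have [_ _ _ g_u _] := mem_gtdivs gu.
  rewrite (lcmn_idPl x_z) !(lcmn_idPl (dvdn_trans _ x_z)) ?(dvdn_trans g_u) //.
  rewrite PoszM exprMn; case: c_a => ->.
    by apply/dvdzP; exists 0%R; ring.
  have /dvdzP[q ->] : (x%:Z ^+ a %| (z%:Z ^+ b)%R)%Z.
    by apply: dvdz_trans (dvdz_exp2l _ le_ab); apply: dvdz_exp2r; rewrite dvdzE.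
  by apply/dvdzP; exists q; rewrite xE !PoszM !exprMn; ring.
have neq_dx : gcdn z x <> x by move=> dE; rewrite -dE dvdn_gcdl in x_nz.
case: (below _ dS (dvdn_gcdr _ _)) => // d_y.
  have [-> ->] := lcmn_diamond xE ux vx gE gu d_y.
  rewrite !PoszM; have -> : forall m n : int, ((v%:Z * m) ^+ b - v%:Z ^+ c * m ^+ b
      - u%:Z ^+ c * (v%:Z * n) ^+ b + (u%:Z * v%:Z) ^+ c * n ^+ b =
      (m ^+ b - u%:Z ^+ c * n ^+ b) * (v%:Z ^+ b - v%:Z ^+ c))%R.
    by move=> m n; rewrite !exprMn; ring.
  by apply: dvdz_mul; [apply: dvdz_lcm_diff | apply: dvdz_subXX].
have [||-> ->] := lcmn_diamond _ vx ux _ gv d_y.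
- by rewrite mulnAC.
- by rewrite gcdnC.
rewrite !PoszM; have -> : forall m n : int, ((u%:Z * m) ^+ b - v%:Z ^+ c * (u%:Z * n) ^+ b
    - u%:Z ^+ c * m ^+ b + (u%:Z * v%:Z) ^+ c * n ^+ b =
    (m ^+ b - v%:Z ^+ c * n ^+ b) * (u%:Z ^+ b - u%:Z ^+ c))%R.
  by move=> m n; rewrite !exprMn; ring.
rewrite mulrAC; apply: dvdz_mul; last by apply: dvdz_subXX.
exact: dvdz_lcm_diff.
Qed.

(** The differences of k-th powers are x^k, y^k (r^k - 1) or g^k (u^k - 1) (v^k - 1); divisibility
    holds factor by factor. *)
Lemma dvdz_mobius_diff_pow (a b x : nat) :
  0 < b -> a %| b -> x \in S ->
  (mobius_diff S 0 x (fun y => y%:Z ^+ a)%R %|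
   mobius_diff S 0 x (fun y => y%:Z ^+ b)%R)%Z.
Proof.
move=> b_gt0 a_b xS; have le_ab : a <= b by apply: dvdn_leq.
have dvd_sub1 (m : int) : (m ^+ a - 1 %| (m ^+ b - 1)%R)%Z.
  by have := dvdz_subXX m (dvdn0 a) a_b (leq0n b); rewrite !expr0 mul1r.
case: (mobius_diffP xS) => [_ E|y r xE _ _ E|g u v xE _ _ _ _ _ _ E]; rewrite !E.
- exact: dvdz_exp2l.
- have factor k : (x%:Z ^+ k - r%:Z ^+ 0 * y%:Z ^+ k =
      y%:Z ^+ k * (r%:Z ^+ k - 1))%R by rewrite xE PoszM exprMn; ring.
  by rewrite !factor dvdz_mul ?dvdz_exp2l.
- have factor k : (x%:Z ^+ k - v%:Z ^+ 0 * (g * u)%:Z ^+ k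
      - u%:Z ^+ 0 * (g * v)%:Z ^+ k + (u * v)%:Z ^+ 0 * g%:Z ^+ k =
      g%:Z ^+ k * ((u%:Z ^+ k - 1) * (v%:Z ^+ k - 1)))%R.
    by rewrite xE !PoszM !exprMn; ring.
  by rewrite !factor !dvdz_mul ?dvdz_exp2l.
Qed.

End GcdClosed.

(** * From Moebius differences to matrix divisibility *)

(* With H the matrix of mobius_diff and F that of weighted_dvd, H = F^-1,
   H A = D F^T for a diagonal D, and B H^T = Q D; hence B = Q D F^T = (Q H) A. *)
Lemma mobius_mx_divides (n c : nat) (S : n.-tuple nat) (fA fB : nat -> nat -> int) :
  uniq S -> (forall x, x \in S -> 0 < x) -> gcd_closed S -> set_condG S ->
  (forall x, x \in S -> size (gtdivs S x) <= 2) ->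
  (forall x y, fA x y = fA y x) ->
  (forall x z, x \in S -> z \in S ->
     mobius_diff S c x (fA z) = (weighted_dvd c z x * mobius_diff S c x (fA x))%R) ->
  (forall x z, x \in S -> z \in S ->
     (mobius_diff S c x (fA x) %| mobius_diff S c x (fB z))%Z) ->
  mx_divides (\matrix_(i < n, j < n) fA (tnth S i) (tnth S j))%R
             (\matrix_(i < n, j < n) fB (tnth S i) (tnth S j))%R.
Proof.
move=> S_uniq S_pos S_gcd S_G S_max fA_sym fAE fB_dvd.
pose s i := tnth S i; have sS i : s i \in S by apply: mem_tnth.
pose H : 'M[int]_n :=
  (\matrix_(k, j) mobius_diff S c (s k) (fun y => (y == s j)%:R%R))%R.
pose F : 'M[int]_n := (\matrix_(i, k) weighted_dvd c (s i) (s k))%R.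
pose d k := mobius_diff S c (s k) (fA (s k)).
(* The quotients are exact by [fB_dvd], also where [d k] is zero, since then the dividend is
   zero. *)
pose Q : 'M[int]_n :=
  (\matrix_(i, k) (mobius_diff S c (s k) (fB (s i)) %/ d k)%Z)%R.
set A := (\matrix_(i, j) fA _ _)%R; set B := (\matrix_(i, j) fB _ _)%R.
have sumH k f : (\sum_j H k j * f (s j))%R = mobius_diff S c (s k) f.
  rewrite -(mobius_diff_sum S_pos S_G S_uniq S_max) // big_tuple.
  by apply: eq_bigr => j _; rewrite mxE.
have HF : (H *m F = 1%:M)%R.
  apply/matrixP => k j; rewrite !mxE.
  under eq_bigr => l _ do rewrite [F l j]mxE.
  rewrite (sumH k (fun y => weighted_dvd c y (s j))).
  by rewrite mobius_diff_weighted_dvd // (inj_eq (tuple_uniqP _ S_uniq)).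
have HA : (H *m A = diag_mx (\row_k d k) *m F^T)%R.
  apply/matrixP => k i; rewrite mul_diag_mx !mxE.
  under eq_bigr => j _ do rewrite [A j i]mxE fA_sym.
  by rewrite (sumH k (fA (s i))) fAE // mulrC.
have BH : (B *m H^T = Q *m diag_mx (\row_k d k))%R.
  apply/matrixP => i k; rewrite mul_mx_diag !mxE.
  under eq_bigr => j _ do rewrite [B i j]mxE [H^T%R j k]mxE mulrC.
  by rewrite (sumH k (fB (s i))) divzK // fB_dvd.
exists (Q *m H)%R; right.
rewrite -mulmxA HA mulmxA -BH -mulmxA -trmx_mul.
by rewrite (mulmx1C HF) trmx1 mulmx1.
Qed.

Theorem theorem1p2 (a b n : nat) (S : n.-tuple nat)
    (a_gt0 : 0 < a) (b_gt0 : 0 < b) (a_dvd_b : a %| b)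
    (S_uniq : uniq S) (S_pos : forall x, x \in S -> 0 < x)
    (S_gcd : gcd_closed S)
    (S_max : \max_(x <- S) size (gtdivs S x) = 2)
    (S_G : set_condG S) :
  mx_divides (power_gcd_mx S a) (power_gcd_mx S b) /\
  mx_divides (power_gcd_mx S a) (power_lcm_mx S b) /\
  mx_divides (power_lcm_mx S a) (power_lcm_mx S b).
Proof.
have size2 x : x \in S -> size (gtdivs S x) <= 2.
  by move=> xS; rewrite -S_max (leq_bigmax_seq x).
have mobius_eq := @mobius_diff_eq S S_pos S_G S_uniq size2.
pose fG e x y := (Posz (gcdn x y) ^+ e)%R.
pose fL e x y := (Posz (lcmn x y) ^+ e)%R.
have gcdE e : power_gcd_mx S e = (\matrix_(i, j) fG e (tnth S i) (tnth S j))%R.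
  by apply/matrixP => i j; rewrite !mxE PoszX.
have lcmE e : power_lcm_mx S e = (\matrix_(i, j) fL e (tnth S i) (tnth S j))%R.
  by apply/matrixP => i j; rewrite !mxE PoszX.
have fG_pow e x z : x \in S -> x %| z ->
    mobius_diff S 0 x (fG e z) = mobius_diff S 0 x (fun y => Posz y ^+ e)%R.
  move=> xS x_z; apply: mobius_eq => // w _ w_x.
  by rewrite /fG (gcdn_idPr (dvdn_trans w_x x_z)).
have fG_mobius e x z : x \in S -> z \in S ->
    mobius_diff S 0 x (fG e z) =
    (weighted_dvd 0 z x * mobius_diff S 0 x (fG e x))%R.
  move=> xS zS; rewrite /weighted_dvd; case: ifPn => [x_z|x_nz].
    by rewrite expr0 mul1r !fG_pow.
  by rewrite mul0r (mobius_diff_gcd0 S_pos S_gcd S_G S_uniq size2 _ xS zS x_nz).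
have fL_mobius x z : x \in S -> z \in S ->
    mobius_diff S a x (fL a z) =
    (weighted_dvd a z x * mobius_diff S a x (fL a x))%R.
  move=> xS zS; rewrite /weighted_dvd; case: ifPn => [x_z|x_nz].
    (* For w | x | z the two lcms are z and x, so the functions differ by the factor (z/x)^a. *)
    rewrite -mobius_diffZ //; apply: mobius_eq => // w _ w_x.
    rewrite /fL (lcmn_idPl w_x) (lcmn_idPl (dvdn_trans w_x x_z)).
    by rewrite -exprMn -PoszM divnK.
  by rewrite mul0r (mobius_diff_lcm0 S_pos S_gcd S_G S_uniq size2 _ xS zS x_nz).
rewrite !gcdE !lcmE; split; [|split].
- apply: (@mobius_mx_divides n 0) => // [x y|x z xS zS|x z xS zS];
    [by rewrite /fG gcdnC | exact: fG_mobius |].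
  rewrite (fG_mobius b) // dvdz_mull // !fG_pow //.
  exact: dvdz_mobius_diff_pow.
- apply: (@mobius_mx_divides n 0) => // [x y|x z xS zS|x z xS zS];
    [by rewrite /fG gcdnC | exact: fG_mobius |].
  rewrite fG_pow //.
  have -> : mobius_diff S 0 x (fun y => Posz y ^+ a)%R =
      mobius_diff S 0 x (fun y => Posz y ^+ a * Posz (x %/ y) ^+ 0)%R.
    by apply: mobius_eq => // w _ _; rewrite mulr1.
  by apply: dvdz_mobius_diff_lcm => //; left.
- apply: (@mobius_mx_divides n a) => // [x y|x z xS zS]; first by rewrite /fL lcmnC.
  (* For y | x, lcm(x, y)^a = x^a = y^a (x/y)^a. *)
  have -> : mobius_diff S a x (fL a x) =
      mobius_diff S a x (fun y => Posz y ^+ a * Posz (x %/ y) ^+ a)%R.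
    apply: mobius_eq => // w _ w_x.
    by rewrite /fL (lcmn_idPl w_x) -exprMn -PoszM mulnC divnK.
  by apply: dvdz_mobius_diff_lcm => //; right.
Qed.
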